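(* Let $(Q,c)\in\mathcal{S}^n\times\mathbb{R}^n$. Then $(Q,c)\in\mathcal{E}_{RS}$, i.e., $\ell^*=\ell^*_{RS}$, if and only if there exist $\hat x\in F$ and $(\hat u,\hat v,\hat W,\hat Y,\hat Z,\hat\beta,\hat h,\hat H)\in\mathbb{R}^n\times\mathbb{R}^n\times\mathcal{S}^n\times\mathbb{R}^{n\times n}\times\mathcal{S}^n\times\mathbb{R}\times\mathbb{R}^n\times\mathcal{S}^n$ such that, with $\hat X=\hat x\hat x^T$, $$Q=\hat W-\hat Y-\hat Y^T+\hat Z+\hat H,\qquad c=-\hat u+\hat v-\hat We+\hat Y^Te+\hat h,$$ $$\begin{bmatrix}\hat\beta&\hat h^T\\\hat h&\hat H\end{bmatrix}\succeq0,\qquad \left\langle\begin{bmatrix}1&\hat x^T\\\hat x&\hat X\end{bmatrix},\begin{bmatrix}\hat\beta&\hat h^T\\\hat h&\hat H\end{bmatrix}\right\rangle=0,$$ $$\hat u^T(e-\hat x)=0,\quad \hat v^T\hat x=0,\quad \langle\hat W,\hat X-\hat xe^T-e\hat x^T+ee^T\rangle=0,\quad \langle\hat Y,e\hat x^T-\hat X\rangle=0,\quad \langle\hat Z,\hat X\rangle=0,$$ $$\hat u\ge0,\quad\hat v\ge0,\quad\hat W\ge0,\quad\hat Y\ge0,\quad\hat Z\ge0.$$ Furthermore, in this case, $\hat x$ is an optimal solution of (BoxQP).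
   Context: Let $n \ge 1$, let $\mathcal{S}^n$ be the space of real symmetric $n\times n$ matrices, $e \in \mathbb{R}^n$ the all-ones vector, $\langle A,B\rangle = \mathrm{trace}(A^TB)$; inequalities $\ge,\le$ on vectors and matrices are componentwise, and $A\succeq0$ means positive semidefinite. For $(Q,c) \in \mathcal{S}^n\times\mathbb{R}^n$ let $q(x) = \frac12 x^TQx + c^Tx$, $F = \{x \in \mathbb{R}^n : 0 \le x \le e\}$; (BoxQP) is the problem $\ell^* = \min_{x\in F} q(x)$. Let $$\mathcal{F}_R = \{(x,X)\in\mathbb{R}^n\times\mathcal{S}^n : 0\le x\le e,\ \max\{x_i+x_j-1,0\}\le X_{ij}\le \min\{x_i,x_j\},\ 1\le i\le j\le n\},$$ $\mathcal{F}_{RS} = \{(x,X)\in\mathcal{F}_R : X-xx^T\succeq0\}$, and $\ell^*_{RS}=\min\{\frac12\langle Q,X\rangle+c^Tx : (x,X)\in\mathcal{F}_{RS}\}$ (the SDP-RLT relaxation). $\mathcal{E}_{RS}=\{(Q,c)\in\mathcal{S}^n\times\mathbb{R}^n : \ell^*=\ell^*_{RS}\}$. *)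

(* Defs.v *)
From HB Require Import structures.
From mathcomp Require Import all_boot all_order all_algebra.
From mathcomp Require Import all_classical all_reals.
Set Implicit Arguments.
Unset Strict Implicit.
Unset Printing Implicit Defensive.
Import Order.TTheory GRing.Theory Num.Theory.
Local Open Scope classical_set_scope.
Local Open Scope ring_scope.

Section Defs.
Context {R : realType} {n : nat}.
Implicit Types (x c u v h : 'cV[R]_n) (Q X W Y Z H : 'M[R]_n).

Definition symmx {m : nat} (A : 'M[R]_m) : Prop := A^T = A.

Definition mxdot {m p : nat} (A B : 'M[R]_(m, p)) : R := \tr (A^T *m B).

Definition mxnonneg {m p : nat} (A : 'M[R]_(m, p)) : Prop :=
  forall i j, 0 <= A i j.

Definition psdmx {m : nat} (A : 'M[R]_m) : Prop :=
  symmx A /\ forall z : 'cV[R]_m, 0 <= (z^T *m A *m z) 0 0.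

Definition ones : 'cV[R]_n := const_mx 1.

Definition qobj Q c x : R := 2^-1 * (x^T *m Q *m x) 0 0 + (c^T *m x) 0 0.

Definition box : set 'cV[R]_n := [set x | forall i, 0 <= x i 0 <= 1].

(* The minimum defining this value is attained, [box] being nonempty and
   compact, so it is the infimum. *)
Definition ell Q c : R := inf [set qobj Q c x | x in box].

Definition boxqp_optimal Q c x : Prop :=
  box x /\ forall y, box y -> qobj Q c x <= qobj Q c y.

Definition FR : set ('cV[R]_n * 'M[R]_n) :=
  [set p | [/\ symmx p.2, box p.1 &
    forall i j : 'I_n, (i <= j)%N ->
      Num.max (p.1 i 0 + p.1 j 0 - 1) 0 <= p.2 i j
        <= Num.min (p.1 i 0) (p.1 j 0)]].

Definition FRS : set ('cV[R]_n * 'M[R]_n) :=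
  [set p | FR p /\ psdmx (p.2 - p.1 *m p.1^T)].

Definition relobj Q c (p : 'cV[R]_n * 'M[R]_n) : R :=
  2^-1 * mxdot Q p.2 + (c^T *m p.1) 0 0.

(* As for [ell]: [FRS] is nonempty and compact. *)
Definition ellRS Q c : R := inf [set relobj Q c p | p in FRS].

Definition ERS : set ('M[R]_n * 'cV[R]_n) :=
  [set p | symmx p.1 /\ ell p.1 p.2 = ellRS p.1 p.2].

(* The bordered matrix [[b, a^T], [a, A]]. *)
Definition bordered (b : R) (a : 'cV[R]_n) (A : 'M[R]_n) : 'M[R]_(1 + n) :=
  block_mx b%:M a^T a A.

Definition certificate Q c x u v W Y Z (beta : R) h H : Prop :=
  let e := ones in
  let X := x *m x^T in
  [/\ symmx W, symmx Z & symmx H] /\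
  [/\ Q = W - Y - Y^T + Z + H,
      c = - u + v - W *m e + Y^T *m e + h,
      psdmx (bordered beta h H) &
      mxdot (bordered 1 x X) (bordered beta h H) = 0] /\
  [/\ (u^T *m (e - x)) 0 0 = 0,
      (v^T *m x) 0 0 = 0,
      mxdot W (X - x *m e^T - e *m x^T + e *m e^T) = 0,
      mxdot Y (e *m x^T - X) = 0 &
      mxdot Z X = 0] /\
  [/\ mxnonneg u, mxnonneg v, mxnonneg W, mxnonneg Y & mxnonneg Z].

End Defs.

(* Main.v *)
Require Import Defs.
From HB Require Import structures.
From mathcomp Require Import all_boot all_order all_algebra.
From mathcomp Require Import all_classical all_reals.
From mathcomp Require Import ring lra.
From mathcomp Require Import topology normedtype derive.
Set Implicit Arguments.
Unset Strict Implicit.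
Unset Printing Implicit Defensive.
Import Order.TTheory GRing.Theory Num.Theory.
Import numFieldTopology.Exports numFieldNormedType.Exports.
Local Open Scope classical_set_scope.
Local Open Scope ring_scope.

(** The relaxation minimises a linear function of [(x, X)] over a convex set
    cut out by two families of linear conditions on the bordered matrix
    [N = bordered 1 x X]: [N] is positive semidefinite, and
    [rlt_factor *m N *m rlt_factor^T], which is built from the four blocks of
    products of the bound factors [x] and [e - x], is entrywise nonnegative.
    A certificate is a dual solution that is complementary to the rank-one
    point [(x, x x^T)].

    Sufficiency is weak duality.  Up to a constant, the stationarity equations
    write the relaxed objective as a sum of products of multipliers and slacks.
    Each product is nonnegative on the relaxation (for the semidefinite one
    this is [psd_mxdot_ge0]) and zero at [(x, x x^T)], so this point is optimal
    for the relaxation, and a fortiori [x] is optimal for the box problem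
    ([certificate_relobj_ge]).

    Necessity is strong duality with attainment.  A minimiser [x] of the box
    problem exists by compactness, and when the two values agree [(x, x x^T)]
    is optimal for the relaxation.  After homogenisation, the matrix
    [B = bordered (- 2 l) c Q], with [l] the common value, has a nonnegative
    inner product with every matrix of the primal cone
    ([relaxed_homogenization]).  Then [conic_duality] writes [B] as
    [rlt_factor^T *m L *m rlt_factor + S] with [L] symmetric and nonnegative and
    [S] positive semidefinite; the blocks of [L] are [Z], [Y], [W], and those of
    [S] are [beta], [h], [H].  The multipliers [u], [v] can be taken to be zero,
    because the diagonal product constraints already force [0 <= x <= e].
    Complementarity follows, since the nonnegative terms of [<B, N>] at
    [(x, x x^T)] add up to zero.

    The duality lemma is proved by projection: among all [(L, S)] in the dual
    cone take one that minimises the Frobenius distance from [B] to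
    [T^T L T + S].  The minimum is attained because a strictly feasible matrix
    (the Slater point, [slater_point]) bounds the multipliers along sublevel
    sets.  If the residual [r] were nonzero, [- r] would lie in the primal cone
    and have a negative inner product with [B]. *)

(** * The trace inner product *)

Section InnerProduct.
Context {R : realType}.

Lemma mxdotE m p (A B : 'M[R]_(m, p)) :
  mxdot A B = \sum_i \sum_j A i j * B i j.
Proof.
rewrite /mxdot /mxtrace exchange_big /=; apply: eq_bigr => i _.
by rewrite mxE; apply: eq_bigr => j _; rewrite mxE.
Qed.

Lemma mxdotC m p (A B : 'M[R]_(m, p)) : mxdot A B = mxdot B A.
Proof. by rewrite /mxdot -mxtrace_tr trmx_mul trmxK. Qed.

Lemma mxdotDr m p (A B C : 'M[R]_(m, p)) :
  mxdot A (B + C) = mxdot A B + mxdot A C.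
Proof. by rewrite /mxdot mulmxDr mxtraceD. Qed.

Lemma mxdotNr m p (A B : 'M[R]_(m, p)) : mxdot A (- B) = - mxdot A B.
Proof. by rewrite /mxdot mulmxN raddfN. Qed.

Lemma mxdotZr m p k (A B : 'M[R]_(m, p)) : mxdot A (k *: B) = k * mxdot A B.
Proof. by rewrite /mxdot -scalemxAr mxtraceZ. Qed.

Lemma mxdot0r m p (A : 'M[R]_(m, p)) : mxdot A 0 = 0.
Proof. by rewrite /mxdot mulmx0 mxtrace0. Qed.

Lemma mxdotDl m p (A B C : 'M[R]_(m, p)) :
  mxdot (B + C) A = mxdot B A + mxdot C A.
Proof. by rewrite mxdotC mxdotDr !(mxdotC A). Qed.

Lemma mxdotNl m p (A B : 'M[R]_(m, p)) : mxdot (- B) A = - mxdot B A.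
Proof. by rewrite mxdotC mxdotNr mxdotC. Qed.

Lemma mxdotZl m p k (A B : 'M[R]_(m, p)) : mxdot (k *: A) B = k * mxdot A B.
Proof. by rewrite mxdotC mxdotZr mxdotC. Qed.

Lemma mxdot_tr m p (A B : 'M[R]_(m, p)) : mxdot A^T B^T = mxdot A B.
Proof. by rewrite /mxdot trmxK mxtrace_mulC -mxtrace_tr trmx_mul trmxK. Qed.

Lemma mxdot_mulr m p q (A : 'M[R]_(m, p)) (B : 'M[R]_(p, q)) C :
  mxdot (A *m B) C = mxdot A (C *m B^T).
Proof. by rewrite /mxdot trmx_mul -mulmxA mxtrace_mulC mulmxA. Qed.

Lemma mxdot_mull m p q (A : 'M[R]_(m, p)) (B : 'M[R]_(p, q)) C :
  mxdot (A *m B) C = mxdot B (A^T *m C).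
Proof. by rewrite /mxdot trmx_mul -mulmxA. Qed.

(** Congruence by [T] is adjoint to congruence by [T^T]: this moves the dual
    multiplier of a constraint on [T *m P *m T^T] onto [P]. *)
Lemma mxdot_congr m p (T : 'M[R]_(p, m)) L P :
  mxdot (T^T *m L *m T) P = mxdot L (T *m P *m T^T).
Proof. by rewrite mxdot_mulr mxdot_mull trmxK mulmxA. Qed.

Lemma mxdot_cV m (a b : 'cV[R]_m) : (a^T *m b) 0 0 = mxdot a b.
Proof. by rewrite /mxdot /mxtrace big_ord1. Qed.

Lemma quad_mxdot m (A : 'M[R]_m) (z : 'cV[R]_m) :
  (z^T *m A *m z) 0 0 = mxdot A (z *m z^T).
Proof.
by rewrite -mulmxA mxdot_cV mxdotC mxdot_mulr.
Qed.

Lemma mxdot_outer m (a b : 'cV[R]_m) :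
  mxdot (a *m a^T) (b *m b^T) = mxdot a b ^+ 2.
Proof.
rewrite -quad_mxdot mulmxA mxdotE.
rewrite -[_ *m a^T *m b]mulmxA mxE big_ord1 !mxdot_cV -mxdotE.
by rewrite (mxdotC b) expr2.
Qed.

Lemma mxdot_ge0 m p (A B : 'M[R]_(m, p)) :
  mxnonneg A -> mxnonneg B -> 0 <= mxdot A B.
Proof.
move=> A0 B0; rewrite mxdotE.
by apply: sumr_ge0 => i _; apply: sumr_ge0 => j _; rewrite mulr_ge0.
Qed.

Lemma mxdotxx_ge0 m p (A : 'M[R]_(m, p)) : 0 <= mxdot A A.
Proof.
rewrite mxdotE.
by apply: sumr_ge0 => i _; apply: sumr_ge0 => j _; rewrite -expr2 sqr_ge0.
Qed.

Lemma mxdotxx_eq0 m p (A : 'M[R]_(m, p)) : mxdot A A = 0 -> A = 0.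
Proof.
rewrite mxdotE => /eqP; rewrite psumr_eq0; last first.
  by move=> i _; apply: sumr_ge0 => j _; rewrite -expr2 sqr_ge0.
move=> /allP A0; apply/matrixP => i j; rewrite mxE.
have /= := A0 i (mem_index_enum i); rewrite psumr_eq0; last first.
  by move=> k _; rewrite -expr2 sqr_ge0.
move=> /allP /(_ j (mem_index_enum j)) /=.
by rewrite -expr2 sqrf_eq0 => /eqP.
Qed.

Lemma mxdot_delta m p (A : 'M[R]_(m, p)) i j : mxdot A (delta_mx i j) = A i j.
Proof.
rewrite mxdotE (bigD1 i)//= (bigD1 j)//= !mxE !eqxx mulr1 !big1 ?addr0//.
  move=> k ki; rewrite big1// => l _.
  by rewrite mxE (negbTE ki) mulr0.
by move=> k kj; rewrite mxE eqxx (negbTE kj) mulr0.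
Qed.

Lemma mxdot_block m1 m2 p1 p2 (A A' : 'M[R]_(m1, p1)) (B B' : 'M[R]_(m1, p2))
    (C C' : 'M[R]_(m2, p1)) (D D' : 'M[R]_(m2, p2)) :
  mxdot (block_mx A B C D) (block_mx A' B' C' D') =
  mxdot A A' + mxdot B B' + mxdot C C' + mxdot D D'.
Proof.
rewrite /mxdot tr_block_mx mulmx_block mxtrace_block !mxtraceD.
ring.
Qed.

Lemma mxdot_bordered n (b b' : R) (a a' : 'cV[R]_n) (A A' : 'M[R]_n) :
  mxdot (bordered b a A) (bordered b' a' A') =
  b * b' + 2 * mxdot a a' + mxdot A A'.
Proof.
rewrite mxdot_block mxdot_tr.
have -> : mxdot (b%:M : 'M_1) b'%:M = b * b'.
  by rewrite /mxdot /mxtrace big_ord1 tr_scalar_mx mul_scalar_mx !mxE eqxx.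
ring.
Qed.

End InnerProduct.

(** * Positive semidefinite matrices *)

Section Psd.
Context {R : realType}.

Lemma bordered_outer n s (z : 'cV[R]_n) :
  col_mx (s%:M : 'M_1) z *m (col_mx s%:M z)^T =
  bordered (s ^+ 2) (s *: z) (z *m z^T).
Proof.
rewrite tr_col_mx mul_col_row tr_scalar_mx /bordered.
by rewrite -scalar_mxM mul_scalar_mx mul_mx_scalar linearZ -expr2.
Qed.

Lemma bordered_quad n b (a : 'cV[R]_n) A s z :
  ((col_mx (s%:M : 'M_1) z)^T *m bordered b a A *m col_mx s%:M z) 0 0 =
  b * s ^+ 2 + 2 * s * mxdot a z + mxdot A (z *m z^T).
Proof.
by rewrite quad_mxdot bordered_outer mxdot_bordered mxdotZr; ring.
Qed.

Lemma symmx_bordered n (M : 'M[R]_(1 + n)) : symmx M ->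
  M = bordered (ulsubmx M 0 0) (dlsubmx M) (drsubmx M) /\ symmx (drsubmx M).
Proof.
move=> sM; split; last by rewrite /symmx trmx_drsub sM.
rewrite /bordered -mx11_scalar.
by rewrite trmx_dlsub sM submxK.
Qed.

Lemma bordered_sym n b (a : 'cV[R]_n) A : symmx A -> symmx (bordered b a A).
Proof.
by move=> sA; rewrite /symmx /bordered tr_block_mx tr_scalar_mx trmxK sA.
Qed.

Lemma split_cV n (z : 'cV[R]_(1 + n)) :
  exists s (y : 'cV[R]_n), z = col_mx (s%:M : 'M_1) y.
Proof.
exists (usubmx z 0 0), (dsubmx z).
by rewrite -mx11_scalar vsubmxK.
Qed.

Lemma bordered_psd n b (a : 'cV[R]_n) A :
  psdmx (bordered b a A) <->
  symmx A /\ forall s z, 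
    0 <= b * s ^+ 2 + 2 * s * mxdot a z + mxdot A (z *m z^T).
Proof.
split=> [[sB qB]|[sA qA]]; split.
- by have [/esym] := symmx_bordered sB; rewrite /bordered block_mxKdr.
- by move=> s z; rewrite -bordered_quad.
- exact: bordered_sym.
- by move=> z; have [s [y ->]] := split_cV z; rewrite bordered_quad.
Qed.

(** Induction on the size, eliminating the first row and column.  The Schur
    complement is positive semidefinite because the quadratic form in the first
    variable has a nonpositive discriminant; when the pivot vanishes, so does
    its whole row, and the convention [0^-1 = 0] makes the same formula for the
    factor valid. *)
Lemma psd_cholesky n (A : 'M[R]_n) : psdmx A ->
  exists L : 'M[R]_n, A = L *m L^T.
Proof.
elim: n A => [|n IH] A psdA.
  by exists 0; apply/matrixP => -[].
have {}psdA : psdmx (A : 'M_(1 + n)) by [].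
have [AE _] := symmx_bordered (psdA.1).
move: psdA AE; set b := ulsubmx _ 0 0; set a := dlsubmx _.
set C := drsubmx _ => psdA AE.
rewrite AE in psdA *; have [sC qC] := (bordered_psd _ _ _).1 psdA.
have b_ge0 : 0 <= b.
  by have := qC 1 0; rewrite mul0mx !mxdot0r; lra.
have qa z : mxdot a z ^+ 2 <= b * mxdot C (z *m z^T).
  have [b0|b_neq0] := eqVneq b 0.
    rewrite b0 mul0r; have [->|az] := eqVneq (mxdot a z) 0.
      by rewrite expr0n.
    have := qC (- (mxdot C (z *m z^T) + 1) / (2 * mxdot a z)) z.
    rewrite b0 mul0r add0r.
    have -> : 2 * (- (mxdot C (z *m z^T) + 1) / (2 * mxdot a z)) * mxdot a z
      = - (mxdot C (z *m z^T) + 1) by field.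
    lra.
  have b_gt0 : 0 < b by rewrite lt_def b_neq0.
  (* the minimiser of the form in its first variable *)
  have := qC (- mxdot a z / b) z.
  rewrite -(pmulr_rge0 _ b_gt0).
  have -> : b * (b * (- mxdot a z / b) ^+ 2 +
    2 * (- mxdot a z / b) * mxdot a z + mxdot C (z *m z^T)) =
    b * mxdot C (z *m z^T) - mxdot a z ^+ 2 by field.
  by rewrite subr_ge0.
have [L CE] : exists L : 'M_n, C - b^-1 *: (a *m a^T) = L *m L^T.
  apply: IH; split.
    by rewrite /symmx linearB linearZ /= trmx_mul trmxK sC.
  move=> z; rewrite quad_mxdot mxdotDl mxdotNl mxdotZl mxdot_outer subr_ge0.
  have [->|b_neq0] := eqVneq b 0.
    by rewrite invr0 mul0r; have := qC 0 z; lra.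
  by rewrite ler_pdivrMl ?lt_def ?b_neq0.
have sbK : (Num.sqrt b * (Num.sqrt b)^-1) *: a = a.
  have [b0|b_neq0] := eqVneq b 0; last first.
    by rewrite divff ?scale1r// sqrtr_eq0 -ltNge lt_def b_neq0.
  suff -> : a = 0 by rewrite scaler0.
  apply/mxdotxx_eq0/eqP; rewrite -sqrf_eq0 eq_le sqr_ge0 andbT.
  by have := qa a; rewrite b0 mul0r.
suff: exists L' : 'M_(1 + n), bordered b a C = L' *m L'^T by [].
exists (block_mx (Num.sqrt b)%:M 0 ((Num.sqrt b)^-1 *: a) L).
rewrite /bordered tr_block_mx mulmx_block !(trmx0, mul0mx, mulmx0, addr0).
rewrite !tr_scalar_mx -scalar_mxM -expr2 sqr_sqrtr//.
rewrite mul_scalar_mx linearZ /= scalerA.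
rewrite -[in LHS]sbK linearZ /= mul_mx_scalar scalerA.
rewrite -scalemxAl -scalemxAr scalerA -expr2 exprVn sqr_sqrtr//.
by rewrite -CE addrC subrK.
Qed.

(** The cone of positive semidefinite matrices is contained in its own dual:
    with [A = L *m L^T] the product is the sum of the values of the form of [B]
    at the columns of [L]. *)
Lemma psd_mxdot_ge0 n (A B : 'M[R]_n) : psdmx A -> psdmx B -> 0 <= mxdot A B.
Proof.
move=> /psd_cholesky[L ->] [_ qB].
rewrite mxdot_mulr trmxK mxdotE exchange_big /=.
apply: sumr_ge0 => j _; have := qB (col j L).
rewrite -mulmxA mxE; congr (0 <= _); apply: eq_bigr => i _.
by rewrite !mxE; congr (_ * _); apply: eq_bigr => k _; rewrite !mxE.
Qed.

Lemma psd_outer n (z : 'cV[R]_n) : psdmx (z *m z^T).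
Proof.
split; first by rewrite /symmx trmx_mul trmxK.
by move=> y; rewrite quad_mxdot mxdot_outer sqr_ge0.
Qed.

Lemma psdD n (A B : 'M[R]_n) : psdmx A -> psdmx B -> psdmx (A + B).
Proof.
move=> [sA qA] [sB qB]; split; first by rewrite /symmx linearD /= sA sB.
by move=> z; rewrite mulmxDr mulmxDl mxE addr_ge0.
Qed.

Lemma psdZ n k (A : 'M[R]_n) : 0 <= k -> psdmx A -> psdmx (k *: A).
Proof.
move=> k0 [sA qA]; split; first by rewrite /symmx linearZ /= sA.
by move=> z; rewrite -scalemxAr -scalemxAl mxE mulr_ge0.
Qed.

Lemma psd0 n : psdmx (0 : 'M[R]_n).
Proof.
split; first by rewrite /symmx trmx0.
by move=> z; rewrite mulmx0 mul0mx mxE.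
Qed.

(** The trace controls all entries, hence bounds a set of positive
    semidefinite matrices. *)
Lemma psd_entry n (A : 'M[R]_n) i j : psdmx A -> `|A i j| <= \tr A.
Proof.
move=> [sA qA].
have sAji : A j i = A i j by rewrite -[in LHS]sA mxE.
have dA k : 0 <= A k k.
  by have := qA (delta_mx k 0); rewrite quad_mxdot trmx_delta mul_delta_mx
    mxdot_delta.
have tr2 : A i i + A j j <= 2 * \tr A.
  rewrite /mxtrace mulr2n mulrDl mul1r; apply: lerD.
    by rewrite (bigD1 i)//= lerDl sumr_ge0.
  by rewrite (bigD1 j)//= lerDl sumr_ge0.
have q s : 0 <= A i i + 2 * s * A i j + s ^+ 2 * A j j.
  have := qA (delta_mx i 0 + s *: delta_mx j 0).
  rewrite quad_mxdot linearD linearZ /= !trmx_delta.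
  rewrite mulmxDl !mulmxDr -!scalemxAl -!scalemxAr !mul_delta_mx.
  rewrite !mxdotDr !mxdotZr !mxdot_delta sAji.
  by congr (0 <= _); ring.
rewrite ler_norml; have := q 1; have := q (-1); lra.
Qed.

End Psd.

(** * Compactness and continuity for matrices *)
Section Topology.
Context {R : realType}.

(** Heine-Borel for matrices, transported from row vectors by [vec_mx]. *)
Lemma compact_mx_itv m p (a b : R) :
  compact [set A : 'M[R]_(m, p) | forall i j, a <= A i j <= b].
Proof.
pose K := [set v : 'rV[R]_(m * p) | forall k, `[a, b]%classic (v ord0 k)].
have -> : [set A : 'M[R]_(m, p) | forall i j, a <= A i j <= b] = vec_mx @` K.
  apply/seteqP; split=> [A hA|_ [v hv <-] i j].
    exists (mxvec A); last by rewrite mxvecK.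
    move=> k; have [i j] := mxvec_indexP k.
    by rewrite /= mxvecE in_itv; exact: hA.
  by have := hv (mxvec_index i j); rewrite /= in_itv mxE.
apply: continuous_compact.
  apply: continuous_subspaceT => v A; move=> /nbhs_ballP[e /= e0 eA].
  apply/nbhs_ballP; exists e => //= w [_ vw]; apply: eA; split => // i j.
  by rewrite !mxE; exact: vw.
apply: (@rV_compact R _ (fun=> `[a, b]%classic)) => _.
exact: segment_compact.
Qed.

Context {T : topologicalType}.

Lemma continuous_sum (I : Type) (r : seq I) (F : I -> T -> R) :
  (forall i, continuous (F i)) -> continuous (fun t => \sum_(i <- r) F i t).
Proof.
by move=> cF; apply: continuous_big => //; exact: add_continuous.
Qed.

Lemma continuous_mxdot m p (F G : T -> 'M[R]_(m, p)) :
  (forall i j, continuous (fun t => F t i j)) ->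
  (forall i j, continuous (fun t => G t i j)) ->
  continuous (fun t => mxdot (F t) (G t)).
Proof.
move=> cF cG.
rewrite (_ : (fun t => _) = fun t => \sum_i \sum_j F t i j * G t i j); last first.
  by apply/funext => t; rewrite mxdotE.
by do 2![apply: continuous_sum => ?] => t; apply: continuousM; [exact: cF|exact: cG].
Qed.

Lemma continuous_mulmx_entry m p q (F : T -> 'M[R]_(m, p)) (G : T -> 'M[R]_(p, q)) :
  (forall i j, continuous (fun t => F t i j)) ->
  (forall i j, continuous (fun t => G t i j)) ->
  forall i j, continuous (fun t => (F t *m G t) i j).
Proof.
move=> cF cG i j.
rewrite (_ : (fun t => _) = fun t => \sum_k F t i k * G t k j); last first.
  by apply/funext => t; rewrite mxE.
by apply: continuous_sum => k t; apply: continuousM; [exact: cF|exact: cG].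
Qed.

Lemma closed_forall_ge0 (I : Type) (F : I -> T -> R) :
  (forall i, continuous (F i)) -> closed [set t | forall i, 0 <= F i t].
Proof.
move=> cF.
rewrite (_ : [set t | _] = \bigcap_(i in setT) (F i @^-1` [set x | 0 <= x])).
  apply: closed_bigI => i _; apply: preimage_closed; last exact: closed_ge.
  by move=> x _; exact: cF.
by apply/seteqP; split=> t h i; [move=> _|]; exact: h.
Qed.

Lemma closed_symmx m (F : T -> 'M[R]_m) :
  (forall i j, continuous (fun t => F t i j)) -> closed [set t | symmx (F t)].
Proof.
move=> cF; rewrite (_ : [set t | _] =
  [set t | forall ij : 'I_m * 'I_m, 0 <= F t ij.1 ij.2 - F t ij.2 ij.1]).
  by apply: closed_forall_ge0 => ij t; apply: continuousB; exact: cF.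
apply/seteqP; split=> t /=.
  by move=> /matrixP s [i j] /=; have := s i j; rewrite mxE => ->; rewrite subrr.
move=> h; apply/matrixP => i j; rewrite mxE; apply/eqP.
by rewrite eq_le -subr_ge0 (h (i, j)) -subr_ge0 (h (j, i)).
Qed.

End Topology.

(** * Conic duality under a Slater condition *)

Lemma mxdot_subZ (R : realType) m p (r g : 'M[R]_(m, p)) s :
  mxdot (r - s *: g) (r - s *: g) =
  mxdot r r - 2 * s * mxdot r g + s ^+ 2 * mxdot g g.
Proof.
rewrite mxdotDl !mxdotDr !mxdotNl !mxdotNr !mxdotZl !mxdotZr (mxdotC g r).
ring.
Qed.

Section Duality.
Context {R : realType} (k m : nat) (T : 'M[R]_(k, m)).

(** The multipliers [(L, S)] dual to the conditions that [T *m P *m T^T] is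
    entrywise nonnegative and that [P] is positive semidefinite. *)
Definition dual_cone (p : 'M[R]_k * 'M[R]_m) : Prop :=
  [/\ symmx p.1, mxnonneg p.1 & psdmx p.2].

Definition dual_map (p : 'M[R]_k * 'M[R]_m) : 'M[R]_m :=
  T^T *m p.1 *m T + p.2.

Lemma dual_map_sym p : dual_cone p -> symmx (dual_map p).
Proof.
move=> [s1 _ [s2 _]]; rewrite /symmx /dual_map linearD /= s2.
by rewrite !trmx_mul trmxK s1 mulmxA.
Qed.

Lemma continuous_fst_entry i j :
  continuous (fun p : 'M[R]_k * 'M[R]_m => p.1 i j).
Proof.
move=> p; apply: (@continuous_comp _ _ _ fst (fun M : 'M[R]_k => M i j)).
  exact: cvg_fst.
exact: coord_continuous.
Qed.

Lemma continuous_snd_entry i j :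
  continuous (fun p : 'M[R]_k * 'M[R]_m => p.2 i j).
Proof.
move=> p; apply: (@continuous_comp _ _ _ snd (fun M : 'M[R]_m => M i j)).
  exact: cvg_snd.
exact: coord_continuous.
Qed.

Lemma continuous_dual_map i j : continuous (fun p => dual_map p i j).
Proof.
rewrite (_ : (fun p => _) =
   fun p : 'M[R]_k * 'M[R]_m => (T^T *m p.1 *m T) i j + p.2 i j); last first.
  by apply/funext => p; rewrite mxE.
have cst a b (A : 'M[R]_(a, b)) i' j' :
  continuous (fun p : 'M[R]_k * 'M[R]_m => A i' j') by move=> p; exact: cvg_cst.
move=> p; apply: continuousD; last exact: continuous_snd_entry.
apply: continuous_mulmx_entry => //; apply: continuous_mulmx_entry => //.
exact: continuous_fst_entry.
Qed.

Lemma closed_dual_cone : closed [set p | dual_cone p].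
Proof.
rewrite (_ : [set p | _] = [set p | symmx p.1] `&`
  [set p : 'M[R]_k * 'M[R]_m | forall ij : 'I_k * 'I_k, 0 <= p.1 ij.1 ij.2] `&`
  [set p | symmx p.2] `&`
  [set p : 'M[R]_k * 'M[R]_m | forall z : 'cV_m, 0 <= mxdot p.2 (z *m z^T)]).
  apply: closedI; first apply: closedI; first apply: closedI.
  - by apply: closed_symmx; exact: continuous_fst_entry.
  - by apply: closed_forall_ge0 => ij; exact: continuous_fst_entry.
  - by apply: closed_symmx; exact: continuous_snd_entry.
  - apply: closed_forall_ge0 => z; apply: continuous_mxdot => i j.
      exact: continuous_snd_entry.
    by move=> p; exact: cvg_cst.
apply/seteqP; split=> p /=.
  move=> [s1 h1 [s2 h2]]; split; last by move=> z; rewrite -quad_mxdot.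
  by do 2!split => //; move=> ij; exact: h1.
move=> [[[s1 h1] s2] h2]; split => //; first by move=> i j; exact: (h1 (i, j)).
by split => // z; rewrite quad_mxdot.
Qed.

Lemma mxdot_dual_map p P :
  mxdot (dual_map p) P = mxdot p.1 (T *m P *m T^T) + mxdot p.2 P.
Proof. by rewrite mxdotDl mxdot_congr. Qed.

Lemma dual_coneD p q : dual_cone p -> dual_cone q ->
  dual_cone (p.1 + q.1, p.2 + q.2).
Proof.
move=> [sp np pp] [sq nq pq]; split => /=; last exact: psdD.
  by rewrite /symmx linearD /= sp sq.
by move=> i j; rewrite mxE addr_ge0.
Qed.

Lemma dual_coneZ a p : 0 <= a -> dual_cone p -> dual_cone (a *: p.1, a *: p.2).
Proof.
move=> a0 [sp np pp]; split => /=; last exact: psdZ.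
  by rewrite /symmx linearZ /= sp.
by move=> i j; rewrite mxE mulr_ge0.
Qed.

Lemma dual_cone_comb a b p q : 0 <= a -> 0 <= b -> dual_cone p -> dual_cone q ->
  exists2 s, dual_cone s & dual_map s = a *: dual_map p + b *: dual_map q.
Proof.
move=> a0 b0 /(dual_coneZ a0) Cp /(dual_coneZ b0) Cq.
exists (a *: p.1 + b *: q.1, a *: p.2 + b *: q.2); first exact: (dual_coneD Cp Cq).
rewrite /dual_map /= mulmxDr mulmxDl -!scalemxAr -!scalemxAl !scalerDr.
by rewrite -!addrA; congr (_ + _); rewrite addrCA.
Qed.

(* A Slater point, with quantitative margins [d] and [t]. *)
Context (P0 : 'M[R]_m) (d t : R).
Context (d_gt0 : 0 < d) (t_gt0 : 0 < t).
Context (psdP0 : psdmx (P0 - d%:M)).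
Context (T_P0 : forall i j, t <= (T *m P0 *m T^T) i j).

(** Pairing with a strictly feasible matrix is a linear functional that
    dominates every entry of the multipliers.  This is what makes the image of
    the dual cone closed. *)
Lemma dual_cone_coercive p : dual_cone p ->
  (forall i j, p.1 i j <= t^-1 * mxdot (dual_map p) P0) /\
  (forall i j, `|p.2 i j| <= d^-1 * mxdot (dual_map p) P0).
Proof.
move=> [_ n1 p2]; rewrite mxdot_dual_map.
have h2 : d * \tr p.2 <= mxdot p.2 P0.
  have := psd_mxdot_ge0 p2 psdP0.
  by rewrite mxdotDr mxdotNr subr_ge0 /mxdot mul_mx_scalar mxtraceZ mxtrace_tr.
have h1 i j : t * p.1 i j <= mxdot p.1 (T *m P0 *m T^T).
  have TP_ge0 a b : 0 <= (T *m P0 *m T^T) a b.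
    exact: le_trans (ltW t_gt0) (T_P0 _ _).
  rewrite mxdotE (bigD1 i)//= (bigD1 j)//= -addrA.
  apply: ler_wpDr; last by rewrite mulrC ler_wpM2l.
  by apply: addr_ge0; apply: sumr_ge0 => ? _; [|apply: sumr_ge0 => ? _];
    rewrite mulr_ge0.
have tr_ge0 : 0 <= \tr p.2.
  rewrite /mxtrace sumr_ge0// => i _.
  have := p2.2 (delta_mx i 0).
  by rewrite quad_mxdot trmx_delta mul_delta_mx mxdot_delta.
have tp2_ge0 : 0 <= mxdot p.2 P0 by apply: le_trans h2; rewrite mulr_ge0// ltW.
have tp1_ge0 : 0 <= mxdot p.1 (T *m P0 *m T^T).
  by apply: mxdot_ge0 => // a b; exact: le_trans (ltW t_gt0) (T_P0 _ _).
split=> i j; rewrite ler_pdivlMl//.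
  by apply: le_trans (h1 i j) _; rewrite lerDl.
apply: (@le_trans _ _ (d * \tr p.2)); last by rewrite ler_wpDl.
by rewrite ler_wpM2l ?(ltW d_gt0)// psd_entry.
Qed.

(** Multipliers that do no worse than [(0, 0)] stay in a compact set: their
    residual [r] satisfies [<r, r> <= <B, B>], and
    [- <r, P0> <= (<P0, P0> + <r, r>) / 2] then bounds the functional of
    [dual_cone_coercive]. *)
Lemma dual_cone_nearest (B : 'M[R]_m) :
  exists2 p, dual_cone p & forall q, dual_cone q ->
    mxdot (B - dual_map p) (B - dual_map p) <=
    mxdot (B - dual_map q) (B - dual_map q).
Proof.
pose D p := mxdot (B - dual_map p) (B - dual_map p).
pose c := mxdot B P0 + (mxdot P0 P0 + mxdot B B) / 2.
pose b := Num.max (t^-1 * c) (d^-1 * c).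
pose K := ([set A : 'M[R]_k | forall i j, - b <= A i j <= b] `*`
           [set A : 'M[R]_m | forall i j, - b <= A i j <= b]) `&`
          [set p | dual_cone p].
have C0 : dual_cone (0, 0).
  split=> /=; [by rewrite /symmx trmx0|by move=> i j; rewrite mxE|exact: psd0].
have D0 : D (0, 0) = mxdot B B.
  by rewrite /D /dual_map /= mulmx0 mul0mx addr0 subr0.
have sub q : dual_cone q -> D q <= mxdot B B -> K q.
  move=> Cq Dq; split => //.
  have hc : mxdot (dual_map q) P0 <= c.
    have sq : 0 <= mxdot P0 P0 + 2 * mxdot (B - dual_map q) P0 + D q.
      have := mxdotxx_ge0 (P0 + (B - dual_map q)); rewrite /D.
      move: (B - dual_map q) => r; rewrite mxdotDl !mxdotDr (mxdotC P0 r).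
      by congr (0 <= _); ring.
    by move: sq Dq; rewrite (mxdotDl P0) mxdotNl /c; lra.
  have [h1 h2] := dual_cone_coercive Cq.
  have [_ n1 _] := Cq.
  have tb : t^-1 * c <= b by rewrite le_max lexx.
  have db : d^-1 * c <= b by rewrite le_max lexx orbT.
  split=> i j /=; rewrite -ler_norml.
    rewrite ger0_norm//; apply: le_trans tb; apply: le_trans (h1 i j) _.
    by rewrite ler_wpM2l// invr_ge0 ltW.
  apply: le_trans db; apply: le_trans (h2 i j) _.
  by rewrite ler_wpM2l// invr_ge0 ltW.
have cD : continuous D.
  have h i j : continuous (fun p => (B - dual_map p) i j).
    rewrite (_ : (fun p => _) =
      fun p : 'M[R]_k * 'M[R]_m => B i j - dual_map p i j); last first.
      by apply/funext => p; rewrite !mxE.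
    move=> p; apply: continuousB; first exact: cvg_cst.
    exact: continuous_dual_map.
  exact: continuous_mxdot.
have K0 : K (0, 0) by apply: sub => //; rewrite D0.
have cK : compact K.
  apply: compact_closedI; last exact: closed_dual_cone.
  by apply: compact_setX; exact: compact_mx_itv.
have [|p pK minp] := @compact_EVT_min _ R D K _ cK (continuous_subspaceT cD).
  by exists (0, 0).
exists p; first by move: pK; rewrite inE => -[].
move=> q Cq; have [le|/ltW gt] := leP (D q) (mxdot B B).
  by apply: minp; rewrite inE; exact: sub.
by apply: le_trans gt; rewrite -D0; apply: minp; rewrite inE.
Qed.

(** Farkas' lemma for the cone of positive semidefinite matrices [P] with
    [T *m P *m T^T] nonnegative.  First-order optimality at the nearest point
    says that the residual is nonpositive on the image of the dual cone and
    orthogonal to the projection; hence the opposite of the residual lies in the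
    primal cone and pairs to [- <r, r>] with [B]. *)
Lemma conic_duality (B : 'M[R]_m) : symmx B ->
  (forall P, psdmx P -> mxnonneg (T *m P *m T^T) -> 0 <= mxdot B P) ->
  exists L S, [/\ symmx L, mxnonneg L, psdmx S & B = T^T *m L *m T + S].
Proof.
move=> sB B_ge0; have [p Cp minp] := dual_cone_nearest B.
set r := B - dual_map p in minp.
have sr : symmx r by rewrite /symmx linearB /= sB dual_map_sym.
(* otherwise a short step of length [s] along [g] would reduce the distance *)
have dir (g : 'M[R]_m) :
    (forall s, 0 < s <= 1 -> exists2 q, dual_cone q & dual_map q = dual_map p + s *: g) ->
    mxdot r g <= 0.
  move=> hg; rewrite leNgt; apply/negP => rg.
  have gg : 0 <= mxdot g g := mxdotxx_ge0 g.
  pose s := Num.min 1 (mxdot r g / (mxdot g g + 1)).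
  have s_gt0 : 0 < s by rewrite lt_min ltr01 divr_gt0// ltr_wpDl.
  have s_le1 : s <= 1 by rewrite ge_min lexx.
  have sgg : s * (mxdot g g + 1) <= mxdot r g.
    by rewrite -ler_pdivlMr ?ltr_wpDl// ge_min lexx orbT.
  have [q /minp + qE] := hg s (introT andP (conj s_gt0 s_le1)).
  rewrite qE opprD addrA -/r mxdot_subZ; nra.
have r_g q : dual_cone q -> mxdot r (dual_map q) <= 0.
  move=> Cq; apply: dir => s /andP[/ltW s0 _].
  have [q' Cq' E] := dual_cone_comb ler01 s0 Cp Cq.
  by exists q' => //; rewrite E scale1r.
have r_p : 0 <= mxdot r (dual_map p).
  rewrite -oppr_le0 -mxdotNr; apply: dir => s /andP[_ s1].
  have [|q' Cq' E] := @dual_cone_comb (1 - s) 0 p p _ (lexx _) Cp Cp.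
    by rewrite subr_ge0.
  by exists q' => //; rewrite E scale0r addr0 scalerBl scale1r scalerN.
have : 0 <= mxdot B (- r).
  apply: B_ge0.
    split; first by rewrite /symmx linearN /= sr.
    move=> z; rewrite quad_mxdot mxdotNl oppr_ge0.
    have := @r_g (0, z *m z^T); rewrite /dual_map /= mulmx0 mul0mx add0r; apply.
    by split=> /=; [rewrite /symmx trmx0|move=> ? ?; rewrite mxE|exact: psd_outer].
  move=> i j; rewrite mulmxN mulNmx mxE oppr_ge0.
  (* dual multipliers are symmetric, so entries are tested in pairs *)
  pose L : 'M[R]_k := delta_mx i j + delta_mx j i.
  have := @r_g (L, 0); rewrite mxdotC mxdot_dual_map mxdotC /= (mxdotC 0) mxdot0r addr0.
  rewrite mxdotDr !mxdot_delta.
  have -> : (T *m r *m T^T) j i = (T *m r *m T^T) i j.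
    by rewrite -[in LHS]sr -[in LHS](trmxK T) -!trmx_mul trmxK mxE mulmxA.
  have CL : dual_cone (L, 0 : 'M[R]_m).
    split=> /=; [|by move=> a b; rewrite !mxE addr_ge0|exact: psd0].
    by rewrite /symmx linearD /= !trmx_delta addrC.
  move/(_ CL); lra.
rewrite mxdotNr oppr_ge0.
have BE : B = r + dual_map p by rewrite subrK.
rewrite {1}BE mxdotDl (mxdotC (dual_map p)) => r_le0.
have /mxdotxx_eq0 r0 : mxdot r r = 0.
  by have := mxdotxx_ge0 r; lra.
have [sL nL pS] := Cp; exists p.1, p.2; split => //.
by rewrite BE r0 add0r.
Qed.

End Duality.

(** * The relaxation in bordered form *)
Section Relaxation.
Context {R : realType} {n : nat}.
Implicit Types (x y a : 'cV[R]_n) (Q X : 'M[R]_n).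
Notation e := (ones : 'cV[R]_n).

(** Maps [(1, x)] to the bound factors [(x, e - x)], so that congruence by it
    turns [bordered 1 x X] into the linearised products of these factors. *)
Definition rlt_factor : 'M[R]_(n + n, 1 + n) := block_mx 0 1%:M e (- 1%:M).

Lemma rlt_congr b a A :
  rlt_factor *m bordered b a A *m rlt_factor^T =
  block_mx A (a *m e^T - A) (e *m a^T - A)
    (A - a *m e^T - e *m a^T + b *: (e *m e^T)).
Proof.
rewrite /rlt_factor /bordered tr_block_mx !mulmx_block.
rewrite !trmx0 !linearN /= !trmx1.
rewrite !(mul0mx, mulmx0, mul1mx, mulmx1, add0r, addr0, mulNmx, mulmxN).
rewrite mulmxDl mul_mx_scalar -scalemxAl mulNmx.
congr block_mx; apply/matrixP => i j; rewrite !mxE !big_ord1 !mxE; ring.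
Qed.

(** Nonnegativity of the congruence is the list of product constraints.  The
    corner [b] is kept general for the homogenised cone. *)
Lemma rlt_nonneg b a A :
  mxnonneg (rlt_factor *m bordered b a A *m rlt_factor^T) <->
  forall i j, [/\ 0 <= A i j, A i j <= a i 0, A i j <= a j 0 &
    a i 0 + a j 0 - b <= A i j].
Proof.
rewrite rlt_congr; split=> [h i j|h i j].
  have := h (lshift n i) (lshift n j); rewrite block_mxEul.
  have := h (lshift n i) (rshift n j); rewrite block_mxEur.
  have := h (rshift n i) (lshift n j); rewrite block_mxEdl.
  have := h (rshift n i) (rshift n j); rewrite block_mxEdr.
  rewrite !mxE !big_ord1 !mxE => ? ? ? ?; split; lra.
case: (split_ordP i) => i' ->; case: (split_ordP j) => j' ->;
  have [] := h i' j';
  rewrite ?(block_mxEul, block_mxEur, block_mxEdl, block_mxEdr);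
  rewrite ?(mxE, big_ord1); lra.
Qed.

Lemma box_outer x : box x -> FRS (x, x *m x^T).
Proof.
move=> xF; split; last by rewrite /= subrr; exact: psd0.
split => //=; first by rewrite /symmx trmx_mul trmxK.
move=> i j _; rewrite mxE big_ord1 mxE.
have /andP[i0 i1] := xF i; have /andP[j0 j1] := xF j.
rewrite ge_max le_min mulr_ge0// andbT.
apply/and3P; split.
- by nra.
- by rewrite ler_piMr.
- by rewrite ler_piMl.
Qed.

(** The bordered form makes the constraint [X - x x^T >= 0] linear (Schur
    complement), and the bounds [0 <= x <= e] are the constraints on the
    diagonal of [X]. *)
Lemma FRS_lift x X : FRS (x, X) <->
  psdmx (bordered 1 x X) /\
  mxnonneg (rlt_factor *m bordered 1 x X *m rlt_factor^T).
Proof.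
have quadE s z : 1 * s ^+ 2 + 2 * s * mxdot x z + mxdot X (z *m z^T) =
    (s + mxdot x z) ^+ 2 + mxdot (X - x *m x^T) (z *m z^T).
  by rewrite mxdotDl mxdotNl mxdot_outer; ring.
split.
  move=> [[/= sX xF XF] [_ psdX]]; split.
    apply/bordered_psd; split=> // s z.
    by rewrite quadE addr_ge0 ?sqr_ge0// -quad_mxdot.
  have XF' (i j : 'I_n) : (i <= j)%N -> [/\ 0 <= X i j, X i j <= x i 0, X i j <= x j 0 &
      x i 0 + x j 0 - 1 <= X i j].
    by move=> /XF; rewrite ge_max le_min => /andP[/andP[? ?] /andP[? ?]].
  apply/rlt_nonneg => i j; have [/XF'//|/ltnW/XF'[]] := leqP i j.
  have -> : X j i = X i j by rewrite -[in LHS]sX mxE.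
  by move=> *; split => //; lra.
move=> [/bordered_psd[sX qX] /rlt_nonneg XF].
split; [split=> //=|split=> /=].
- by move=> i; have [? ? ? ?] := XF i i; apply/andP; split; lra.
- move=> i j _; have [? ? ? ?] := XF i j.
  by rewrite ge_max le_min; apply/andP; split; apply/andP.
- by rewrite /symmx linearB /= sX trmx_mul trmxK.
- move=> z; rewrite quad_mxdot; have := qX (- mxdot x z) z.
  by rewrite quadE addNr expr0n add0r.
Qed.

Lemma bordered_relobj f c Q x X :
  mxdot (bordered f c Q) (bordered 1 x X) = f + 2 * relobj Q c (x, X).
Proof. by rewrite mxdot_bordered /relobj /= mxdot_cV; field. Qed.

Lemma relobj_outer Q c x : relobj Q c (x, x *m x^T) = qobj Q c x.
Proof. by rewrite /relobj /qobj /= quad_mxdot. Qed.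

Lemma continuous_qobj (T : topologicalType) (F : T -> 'cV[R]_n) Q c :
  (forall i j, continuous (fun t => F t i j)) ->
  continuous (fun t => qobj Q c (F t)).
Proof.
move=> cF; have cst p q (A : 'M[R]_(p, q)) i j :
  continuous (fun t : T => A i j) by move=> t; exact: cvg_cst.
pose quad t := mxdot (2^-1 *: Q) (F t *m (F t)^T).
pose lin t := mxdot c (F t).
have -> : (fun t => qobj Q c (F t)) = (fun t => quad t + lin t).
  by apply/funext => t; rewrite /quad /lin mxdotZl -quad_mxdot -mxdot_cV.
have clin : continuous lin by exact: continuous_mxdot.
suff cquad : continuous quad.
  by move=> t; apply: continuousD; [exact: cquad|exact: clin].
apply: continuous_mxdot => i j; first exact: cst.
apply: continuous_mulmx_entry => {}i {}j; first exact: cF.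
rewrite (_ : (fun t => _) = fun t => F t j i); first exact: cF.
by apply/funext => u; rewrite mxE.
Qed.

Lemma boxqp_attained Q c : exists x, boxqp_optimal Q c x.
Proof.
have boxE : box = [set x : 'cV[R]_n | forall i j, 0 <= x i j <= 1].
  by apply/seteqP; split=> x h i; [move=> j; rewrite ord1|]; exact: h.
have cq : continuous (qobj Q c).
  by apply: (@continuous_qobj _ id) => i j; exact: coord_continuous.
have cb : compact (@box R n) by rewrite boxE; exact: compact_mx_itv.
have [|x xF minx] := compact_EVT_min _ cb (continuous_subspaceT cq).
  by exists 0 => i; rewrite mxE lexx ler01.
exists x; split; first by move: xF; rewrite inE.
by move=> y yF; apply: minx; rewrite inE.
Qed.

Lemma inf_attained (S : set R) (y : R) : S y -> lbound S y -> inf S = y.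
Proof.
move=> Sy lby; apply/le_anti/andP; split.
  by apply: ge_inf => //; exists y.
by apply: lb_le_inf => //; exists y.
Qed.

Lemma ell_optimal Q c x : boxqp_optimal Q c x -> ell Q c = qobj Q c x.
Proof.
move=> [xF minx]; apply: inf_attained; first by exists x.
by move=> _ [y yF <-]; exact: minx.
Qed.

Lemma mxdot_lbound m p (A B : 'M[R]_(m, p)) :
  (forall i j, 0 <= B i j <= 1) -> - (\sum_i \sum_j `|A i j|) <= mxdot A B.
Proof.
move=> B01; rewrite mxdotE -sumrN; apply: ler_sum => i _.
rewrite -sumrN; apply: ler_sum => j _; have /andP[B0 B1] := B01 i j.
rewrite lerNl; apply: le_trans (ler_norm _) _.
by rewrite normrN normrM ler_piMr// ger0_norm.
Qed.

(** The infimum of a set that is unbounded below is zero by convention, so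
    [ellRS] is a lower bound only once this is known. *)
Lemma FRS_has_lbound Q c : has_lbound [set relobj Q c p | p in FRS].
Proof.
exists (2^-1 * - (\sum_i \sum_j `|Q i j|) + - (\sum_i \sum_j `|c i j|)).
move=> _ [[x X] pF <-]; rewrite /relobj /= mxdot_cV.
have [/= xF _] := pF; have [_ xF' _] := xF.
have [_ /rlt_nonneg XF] := (FRS_lift _ _).1 pF.
have x01 i : 0 <= x i 0 <= 1 := xF' i.
apply: lerD; last by apply: mxdot_lbound => i j; rewrite ord1.
rewrite ler_pM2l ?invr_gt0//; apply: mxdot_lbound => i j.
have [? ? ? ?] := XF i j; have := x01 i; lra.
Qed.

Lemma ERS_relobj_ge Q c p : ell Q c = ellRS Q c -> FRS p ->
  ell Q c <= relobj Q c p.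
Proof.
move=> -> pF; apply: ge_inf; first exact: FRS_has_lbound.
by exists p.
Qed.

End Relaxation.

(** * A strictly feasible point *)

Section Slater.
Context {R : realType} {n : nat}.
Notation e := (ones : 'cV[R]_n).

(** The centre [x = e / 2] of the box with [X = x x^T + I / 8]. *)
Definition slater_point : 'M[R]_(1 + n) :=
  bordered 1 (2^-1 *: e) (4^-1 *: (e *m e^T) + 8^-1%:M).

Lemma slater_rlt i j :
  8^-1 <= (rlt_factor *m slater_point *m rlt_factor^T) i j.
Proof.
rewrite rlt_congr; case: (split_ordP i) => k ->; case: (split_ordP j) => l ->;
  rewrite ?(block_mxEul, block_mxEur, block_mxEdl, block_mxEdr);
  rewrite !(mxE, big_ord1);
  case: (k == l); rewrite ?mulr0n ?mulr1n; lra.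
Qed.

(** The Cauchy-Schwarz inequality, from the squared norm of the component of
    [B] orthogonal to [A]. *)
Lemma mxdot_cauchy m p (A B : 'M[R]_(m, p)) :
  mxdot A B ^+ 2 <= mxdot A A * mxdot B B.
Proof.
have [/eqP A0|A0] := boolP (mxdot A A == 0).
  by rewrite (mxdotxx_eq0 A0) mxdotC !mxdot0r mul0r expr0n.
have Agt0 : 0 < mxdot A A by rewrite lt_def A0 mxdotxx_ge0.
have := mxdotxx_ge0 (B - (mxdot A B / mxdot A A) *: A).
rewrite mxdot_subZ (mxdotC B A) -(pmulr_rge0 _ Agt0).
have -> : mxdot A A * (mxdot B B - 2 * (mxdot A B / mxdot A A) * mxdot A B +
    (mxdot A B / mxdot A A) ^+ 2 * mxdot A A) =
  mxdot A A * mxdot B B - mxdot A B ^+ 2 by field.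
by rewrite subr_ge0.
Qed.

(** With [N = <e, e>], the margin [d] is chosen so that [d (N + 1) = 1 / 8]:
    part of the term [I / 8] of the Slater point pays for [d] on the lower block,
    the rest for the cross term [<e, z> ^+ 2 <= N * <z, z>]. *)
Lemma slater_psd :
  exists2 d : R, 0 < d & psdmx (slater_point - d%:M).
Proof.
pose N := mxdot e e; have N0 : 0 <= N := mxdotxx_ge0 e.
pose d : R := (8 * (N + 1))^-1.
have d0 : 0 < d by rewrite invr_gt0; lra.
have dN : d * (N + 1) = 8^-1 by rewrite /d; field; lra.
exists d => //.
have -> : slater_point - d%:M =
    bordered (1 - d) (2^-1 *: e) (4^-1 *: (e *m e^T) + (8^-1 - d)%:M).
  rewrite /slater_point /bordered (scalar_mx_block 1 n) opp_block_mx.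
  by rewrite add_block_mx !oppr0 !addr0 -addrA -!raddfB.
apply/bordered_psd; split.
  by rewrite /symmx linearD linearZ /= trmx_mul trmxK tr_scalar_mx.
move=> s z; rewrite mxdotDl !mxdotZl mxdot_outer.
have -> : mxdot ((8^-1 - d)%:M) (z *m z^T) = (8^-1 - d) * mxdot z z.
  by rewrite -quad_mxdot mul_mx_scalar -scalemxAl mxE mxdot_cV.
have := mxdot_cauchy e z; rewrite -/N.
have := mxdotxx_ge0 z; move: (mxdot e z) (mxdot z z) => w q q0 wNq.
(* uses [s ^+ 2 = 2 * (s + w / 2) ^+ 2 + w ^+ 2 / 2 - (s + w) ^+ 2],
   weighted by [d] *)
have -> : (1 - d) * s ^+ 2 + 2 * s * (2^-1 * w) +
    (4^-1 * w ^+ 2 + (8^-1 - d) * q) =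
  (s + w / 2) ^+ 2 * (1 - 2 * d) + d * (s + w) ^+ 2 +
  (d / 2) * (N * q - w ^+ 2) + d * N / 2 * q.
  by rewrite -dN; field.
have d1 : 2 * d <= 1 by nra.
by rewrite !addr_ge0// mulr_ge0 ?sqr_ge0 ?subr_ge0 ?divr_ge0 ?mulr_ge0 ?(ltW d0).
Qed.

End Slater.

(** * Optimality certificates *)
Section KKT.
Context {R : realType} {n : nat}.
Implicit Types (x y a c : 'cV[R]_n) (Q X A : 'M[R]_n).
Notation e := (ones : 'cV[R]_n).

Lemma bordered_scale k b a A :
  k *: bordered b a A = bordered (k * b) (k *: a) (k *: A).
Proof. by rewrite /bordered scale_block_mx scale_scalar_mx linearZ. Qed.

(** A matrix of the primal cone with a positive corner is a positive multiple
    of a bordered feasible point; a zero corner is reached in the limit by adding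
    a small multiple of the Slater point. *)
Lemma relaxed_homogenization Q c f P :
  (forall p, FRS p -> f <= relobj Q c p) ->
  psdmx P -> mxnonneg (rlt_factor *m P *m rlt_factor^T) ->
  0 <= mxdot (bordered (- (2 * f)) c Q) P.
Proof.
move=> f_le psdP rltP; set B := bordered _ c Q.
have pos b a A : 0 < b -> psdmx (bordered b a A) ->
    mxnonneg (rlt_factor *m bordered b a A *m rlt_factor^T) ->
    0 <= mxdot B (bordered b a A).
  move=> b0 psdM rltM.
  rewrite -(pmulr_rge0 _ (_ : 0 < b^-1)) ?invr_gt0// -mxdotZr bordered_scale.
  rewrite mulVf ?gt_eqF// bordered_relobj.
  suff /f_le : FRS (b^-1 *: a, b^-1 *: A) by lra.
  have b'0 : 0 <= b^-1 by rewrite invr_ge0 ltW.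
  apply/FRS_lift; have -> : bordered 1 (b^-1 *: a) (b^-1 *: A) = b^-1 *: bordered b a A.
    by rewrite bordered_scale mulVf ?gt_eqF.
  split; first exact: psdZ.
  by move=> i j; rewrite -scalemxAr -scalemxAl mxE mulr_ge0.
have [d d0 psdS] := @slater_psd R n.
have {}psdS : psdmx (slater_point : 'M[R]_(1 + n)).
  rewrite -(subrK (d%:M) slater_point); apply: psdD => //.
  split; first by rewrite /symmx tr_scalar_mx.
  move=> z; rewrite mul_mx_scalar -scalemxAl mxE mxdot_cV.
  by rewrite mulr_ge0 ?mxdotxx_ge0// ltW.
have near eps : 0 < eps -> 0 <= mxdot B P + eps * mxdot B slater_point.
  move=> eps0; rewrite -mxdotZr -mxdotDr.
  set M := P + eps *: slater_point.
  have psdM : psdmx M by apply: psdD => //; apply: psdZ => //; exact: ltW.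
  have rltM : mxnonneg (rlt_factor *m M *m rlt_factor^T).
    move=> i j; rewrite mulmxDr mulmxDl -scalemxAr -scalemxAl mxE.
    rewrite addr_ge0// mxE mulr_ge0 ?(ltW eps0)//.
    by apply: le_trans (slater_rlt i j); rewrite invr_ge0.
  have [ME _] := symmx_bordered psdM.1.
  have b0 : 0 < ulsubmx M 0 0.
    have [PE _] := symmx_bordered psdP.1.
    have := psdP; rewrite PE => /bordered_psd[_ /(_ 1 0)].
    rewrite mul0mx !mxdot0r => p0.
    move: (ulsubmx P 0 0) (dlsubmx P) (drsubmx P) PE p0 => p a A PE p0.
    rewrite /M PE /slater_point bordered_scale /bordered add_block_mx.
    rewrite block_mxKul !mxE eqxx !mulr1n; move: p0; rewrite expr1n; lra.
  move: (ulsubmx M 0 0) (dlsubmx M) (drsubmx M) ME b0 => b a A ME b0.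
  by move: psdM rltM; rewrite ME => ? ?; exact: pos.
rewrite leNgt; apply/negP => BP_lt0.
set w := mxdot B slater_point in near.
have w0 : 0 < `|w| + 1 by rewrite ltr_wpDl.
have := near (- mxdot B P / (2 * (`|w| + 1))).
rewrite divr_gt0 ?oppr_gt0 ?mulr_gt0// => /(_ isT).
apply/negP; rewrite -ltNge.
have -> : mxdot B P + - mxdot B P / (2 * (`|w| + 1)) * w =
  mxdot B P / (2 * (`|w| + 1)) * (2 * (`|w| + 1) - w) by field; lra.
rewrite pmulr_llt0; last by have := ler_norm w; lra.
by rewrite pmulr_llt0// invr_gt0 mulr_gt0.
Qed.

(** The dual side of the product constraints: the off-diagonal and lower
    blocks are the contributions of [W], [Y], [Z] to the stationarity equations. *)
Lemma rlt_pullback (Z Y W : 'M[R]_n) :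
  rlt_factor^T *m block_mx Z Y^T Y W *m rlt_factor =
  block_mx (e^T *m W *m e) (e^T *m (Y - W)) ((Y^T - W) *m e) (W - Y - Y^T + Z).
Proof.
rewrite /rlt_factor tr_block_mx !mulmx_block.
rewrite !trmx0 !linearN /= !trmx1.
rewrite !(mul0mx, mulmx0, mul1mx, mulmx1, add0r, addr0, mulNmx, mulmxN).
congr block_mx; first by rewrite mulmxBr addrC.
by apply/matrixP => i j; rewrite !mxE; ring.
Qed.

(** Strong duality, with [u = v = 0]; complementarity is obtained by pairing
    the decomposition of the objective with the bordered matrix of
    [(x, x x^T)]. *)
Lemma certificate_exists Q c x : symmx Q -> boxqp_optimal Q c x ->
  (forall p, FRS p -> qobj Q c x <= relobj Q c p) ->
  exists (u v : 'cV[R]_n) (W Y Z : 'M[R]_n) (beta : R) (h : 'cV[R]_n)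
    (H : 'M[R]_n), certificate Q c x u v W Y Z beta h H.
Proof.
move=> sQ [xF _] minx; set f := qobj Q c x in minx.
have [d d0 psdS] := @slater_psd R n.
have e8 : 0 < 8^-1 :> R by rewrite invr_gt0.
have [L [S [sL nL psdM]]] := conic_duality d0 e8 psdS slater_rlt
  (bordered_sym (- (2 * f)) c sQ) (fun P => relaxed_homogenization minx).
have [SE _] := symmx_bordered psdM.1.
have sD : symmx (drsubmx S) by rewrite /symmx trmx_drsub psdM.1.
move: SE sD psdM; move: (ulsubmx S 0 0) (dlsubmx S) (drsubmx S) => beta h H.
move=> -> sH psdM {S}.
pose Z := ulsubmx L; pose Y := dlsubmx L; pose W := drsubmx L.
have sZ : symmx Z by rewrite /symmx trmx_ulsub sL.
have sW : symmx W by rewrite /symmx trmx_drsub sL.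
have LE : L = block_mx Z Y^T Y W by rewrite trmx_dlsub sL submxK.
have nZ : mxnonneg Z by move=> i j; rewrite !mxE.
have nY : mxnonneg Y by move=> i j; rewrite !mxE.
have nW : mxnonneg W by move=> i j; rewrite !mxE.
move=> BE.
have [psdX rltX] := (FRS_lift _ _).1 (box_outer xF).
have Mge := psd_mxdot_ge0 psdX psdM.
have := bordered_relobj (- (2 * f)) c Q x (x *m x^T).
rewrite relobj_outer -/f addNr BE mxdotDl mxdot_congr mxdotC.
rewrite rlt_congr LE scale1r in rltX *; rewrite mxdot_block.
rewrite -[X in _ + mxdot X Y^T]trmxK mxdot_tr linearB /= !trmx_mul !trmxK.
rewrite (mxdotC _ (bordered 1 x _)).
have nXs : [/\ mxnonneg (x *m x^T), mxnonneg (e *m x^T - x *m x^T) &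
   mxnonneg (x *m x^T - x *m e^T - e *m x^T + e *m e^T)].
  split=> i j.
  - by have := rltX (lshift n i) (lshift n j); rewrite block_mxEul.
  - by have := rltX (rshift n i) (lshift n j); rewrite block_mxEdl.
  - by have := rltX (rshift n i) (rshift n j); rewrite block_mxEdr.
have [nX1 nX2 nX3] := nXs.
have := mxdot_ge0 nZ nX1; have := mxdot_ge0 nY nX2; have := mxdot_ge0 nW nX3.
rewrite !(mxdotC _ Z) !(mxdotC _ Y) !(mxdotC _ W) => W0 Y0 Z0 sum0.
move: BE; rewrite LE rlt_pullback /bordered add_block_mx.
move/eq_block_mx => [_ _ cE QE].
exists 0, 0, W, Y, Z, beta, h, H; split=> //; split.
  split=> //; last lra.
  by rewrite oppr0 !add0r cE mulmxBl [- _ + _]addrC.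
split; last by split=> // i j; rewrite mxE.
by split; rewrite ?trmx0 ?mul0mx ?mxE//; lra.
Qed.

Lemma mxdot_ones x (A : 'M[R]_n) : mxdot (A *m e) x = mxdot A (x *m e^T).
Proof. exact: mxdot_mulr. Qed.

(** Weak duality: [slack] collects the products of multipliers and slacks,
    and differs from the relaxed objective by the constant [K]. *)
Lemma certificate_relobj_ge Q c x u v W Y Z beta h H :
  box x -> certificate Q c x u v W Y Z beta h H ->
  forall p, FRS p -> qobj Q c x <= relobj Q c p.
Proof.
move=> xF [[sW sZ sH] [[QE cE psdM M0] [[u0 v0 W0 Y0 Z0] [nu nv nW nY nZ]]]].
move=> [y X] yF.
pose slack y X := 2^-1 * mxdot W (X - y *m e^T - e *m y^T + e *m e^T) +
  mxdot Y (e *m y^T - X) + 2^-1 * mxdot Z X + mxdot u (e - y) + mxdot v y +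
  2^-1 * mxdot (bordered 1 y X) (bordered beta h H).
pose K := 2^-1 * mxdot W (e *m e^T) + mxdot u e + 2^-1 * beta.
have lagrangian y' X' : symmx X' -> relobj Q c (y', X') = slack y' X' - K.
  move=> sX; rewrite /relobj /slack /K /= mxdot_cV mxdot_bordered QE cE.
  rewrite !(mxdotDl, mxdotDr, mxdotNl, mxdotNr).
  rewrite !mxdot_ones.
  have -> : mxdot Y^T X' = mxdot Y X' by rewrite -{1}sX mxdot_tr.
  have -> : mxdot Y^T (y' *m e^T) = mxdot Y (e *m y'^T).
    by rewrite -mxdot_tr trmxK trmx_mul trmxK.
  have -> : mxdot W (e *m y'^T) = mxdot W (y' *m e^T).
    by rewrite -{1}sW -[in RHS]mxdot_tr trmx_mul trmxK.
  rewrite (mxdotC X') (mxdotC y'); by field.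
have [[/= symX yb _] _] := yF.
have [psdX /rlt_nonneg rltX] := (FRS_lift _ _).1 yF.
have sx : symmx (x *m x^T) by rewrite /symmx trmx_mul trmxK.
rewrite -relobj_outer !lagrangian// lerD2r.
have -> : slack x (x *m x^T) = 0.
  move: u0 v0; rewrite !mxdot_cV => u0 v0.
  by rewrite /slack W0 Y0 Z0 u0 v0 M0; ring.
rewrite /slack; apply: addr_ge0; last first.
  by rewrite mulr_ge0 ?invr_ge0 ?psd_mxdot_ge0.
have half A B : mxnonneg A -> mxnonneg B -> 0 <= 2^-1 * mxdot A B.
  by move=> nA nB; rewrite mulr_ge0 ?invr_ge0 ?mxdot_ge0.
rewrite !addr_ge0//; try apply: half => //; try apply: mxdot_ge0 => //; move=> i j;
  try have [? ? ? ?] := rltX i j; try have /andP[? ?] := yb i;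
  rewrite ?ord1 ?(mxE, big_ord1) //; try lra.
Qed.

End KKT.

(** * Tightness of the relaxation *)

Theorem proposition5p1 (R : realType) (n : nat) (hn : (1 <= n)%N)
    (Q : 'M[R]_n) (c : 'cV[R]_n) (hQ : symmx Q) :
  (ERS (Q, c) <->
     exists xh : 'cV[R]_n, box xh /\
       exists (u v : 'cV[R]_n) (W Y Z : 'M[R]_n)
              (beta : R) (h : 'cV[R]_n) (H : 'M[R]_n),
         certificate Q c xh u v W Y Z beta h H) /\
  (forall (xh u v : 'cV[R]_n) (W Y Z : 'M[R]_n)
          (beta : R) (h : 'cV[R]_n) (H : 'M[R]_n),
     box xh -> certificate Q c xh u v W Y Z beta h H ->
     boxqp_optimal Q c xh).
Proof.
have optimal xh u v W Y Z beta h H : box xh ->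
    certificate Q c xh u v W Y Z beta h H -> boxqp_optimal Q c xh.
  move=> xF cert; split=> // y yF; rewrite -[leRHS]relobj_outer.
  exact: certificate_relobj_ge cert _ (box_outer yF).
split; [split|exact: optimal].
  move=> [_ tight]; have [x xopt] := boxqp_attained Q c.
  exists x; split; first exact: xopt.1.
  apply: certificate_exists => // p pF.
  by rewrite -(ell_optimal xopt); exact: ERS_relobj_ge.
move=> [x [xF [u [v [W [Y [Z [beta [h [H cert]]]]]]]]]]; split => //=.
rewrite (ell_optimal (optimal _ _ _ _ _ _ _ _ _ xF cert)).
apply/esym/inf_attained.
  by exists (x, x *m x^T); [exact: box_outer|exact: relobj_outer].
by move=> _ [p pF <-]; exact: certificate_relobj_ge cert p pF.
Qed.
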